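(* Let $\varepsilon>0$ be a constant and let $q\ge n$. Suppose the edges of $G_{n,p}$ are independently colored with uniformly random colors from $[q]$. There is a constant $K=K(\varepsilon)$ such that if $p\ge \frac{K\log n}{n}$ then with probability tending to $1$ as $n\to\infty$, $G_{n,p}$ contains a rainbow Hamilton cycle $H$ with $\iota(H)\le\varepsilon n^2$.
   Context: $G_{n,p}$ is the random graph on vertex set $[n]$ in which each of the $\binom n2$ possible edges is present independently with probability $p$. A Hamilton cycle is rainbow if all its edges have distinct colors. A Hamilton cycle $H$ is treated as the sequence $(i_1=1,i_2,\ldots,i_n)$ of its vertices listed in cyclic order starting from vertex $1$, and $\iota(H)=|\{(k,\ell):k<\ell,\ i_k>i_\ell\}|$ is its number of inversions. *)

(* Defs.v *)
From mathcomp Require Import all_boot all_order all_fingroup all_algebra.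
From mathcomp Require Import all_classical all_reals all_analysis.

Set Implicit Arguments.
Unset Strict Implicit.
Unset Printing Implicit Defensive.

Import Order.TTheory GRing.Theory Num.Theory.
Local Open Scope ring_scope.

(* The vertex set [n] is 'I_n, so the vertex called 1 on paper is 0 here. *)

(* The 'C(n, 2) possible edges: two-element sets of vertices. *)
Definition pedge (n : nat) := {e : {set 'I_n} | #|e| == 2%N}.

(* A graph on 'I_n with its edges coloured by 'I_q: a possible edge is sent to
   None if it is absent and to Some c if it is present with colour c. *)
Definition cgraph (n q : nat) := {ffun pedge n -> option 'I_q}.

Definition edges (n q : nat) (w : cgraph n q) : {set pedge n} :=
  [set e | isSome (w e)].

(* None also when x = y, since then [set x; y] is not a possible edge. *)
Definition edge_colour (n q : nat) (w : cgraph n q) (x y : 'I_n) : option 'I_q :=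
  if insub [set x; y] is Some e then w e else None.

(* Probability that G_{n,p} is the graph with edge set E. *)
Definition gnp (R : realType) (n : nat) (p : R) (E : {set pedge n}) : R :=
  \prod_(e : pedge n) (if e \in E then p else 1 - p).

(* Probability of the coloured graph w: draw its edge set from G_{n,p}, then
   colour each edge independently and uniformly with one of the q colours. *)
Definition colgnp (R : realType) (n q : nat) (p : R) (w : cgraph n q) : R :=
  gnp p (edges w) * \prod_(e in edges w) q%:R^-1.

Definition Pr_colgnp (R : realType) (n q : nat) (p : R)
  (A : pred (cgraph n q)) : R := \sum_(w | A w) colgnp p w.

(* A Hamilton cycle is a permutation H of 'I_n, read as the vertex sequence
   H 0, H 1, ..., H (n - 1), with H 0 = 0; it has at least 3 vertices, and ordS
   is the cyclic successor, so the closing edge {H (n - 1), H 0} is included. *)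
Definition hamilton_cycle (n q : nat) (w : cgraph n q) (H : {perm 'I_n}) : bool :=
  [&& (2 < n)%N,
      [forall k : 'I_n, (k == 0%N :> nat) ==> (H k == 0%N :> nat)]
    & [forall k : 'I_n, isSome (edge_colour w (H k) (H (ordS k)))]].

Definition rainbow (n q : nat) (w : cgraph n q) (H : {perm 'I_n}) : bool :=
  injectiveb (fun k : 'I_n => edge_colour w (H k) (H (ordS k))).

Definition inversions (n : nat) (H : {perm 'I_n}) : nat :=
  #|[set kl : 'I_n * 'I_n | (kl.1 < kl.2)%N && (H kl.2 < H kl.1)%N]|.

Definition has_rainbow_HC (R : realType) (n q : nat) (eps : R) :
    pred (cgraph n q) :=
  fun w => [exists H : {perm 'I_n},
    [&& hamilton_cycle w H, rainbow w H
      & (inversions H)%:R <= eps * n%:R ^+ 2]].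

(* Main.v *)
(** Consider the hypergraph on the ground set (possible edges) x (colours) whose
hyperedges are the rainbow coloured Hamilton cycles obtained by permuting
arbitrarily the vertices inside consecutive blocks of length about [eps * n / 4];
these have few inversions.  The uniform measure on them is spread: a set of [u]
coloured edges lies in at most a fraction [(64 / (b * q)) ^ u] of them, where [b]
is the block length.  Hence a family of sets covering all hyperedges has cost at
least 1 for the weight [w = 64 / (b * q)].  The argument of Park and Pham for the
Kahn-Kalai conjecture exposes a random subset of the ground set in about
[log2 n] rounds, the round with fragments of size about [2 ^ j] having density
[L j * w]; on failure the large fragments form a cover whose expected cost is at
most [\sum_j (4 / L j) ^ (2 ^ j)].  Taking [L j = 8] for all but boundedly many
rounds, and large constants in those, makes this as small as we please with total
density [O (log n / (n * q))].  Finally, the model in which an edge gets at most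
one colour fares at least as well as independent coloured edges of the same
density: a hyperedge uses an edge at most once, so that, edge by edge, the
union bound compares the two models. *)

Require Import Defs.
From mathcomp Require Import all_boot all_order all_fingroup all_algebra.
From mathcomp Require Import reals.
From mathcomp Require Import zify ring lra.
Import Order.TTheory GRing.Theory Num.Theory.

Set Implicit Arguments.
Unset Strict Implicit.
Unset Printing Implicit Defensive.

Local Open Scope ring_scope.

(** * Comparison of product measures *)

Section ProductComparison.
Variables (R : realFieldType) (I T : finType).

Definition upd (s : {ffun I -> T}) (i : I) (t : T) : {ffun I -> T} :=
  [ffun j => if j == i then t else s j].

(** Exchanging [t] with [s i] is an involution on pairs [(s, t)], and it turns [upd s i t] into
    [s]. *)
Lemma sum_upd (i : I) (F : {ffun I -> T} -> R) :
  \sum_s \sum_t F (upd s i t) = #|T|%:R * \sum_s F s.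
Proof.
rewrite pair_big /=.
pose g (p : {ffun I -> T} * T) := (upd p.1 i p.2, p.1 i).
have gK : involutive g.
  move=> [s t]; rewrite /g /=; congr pair; last by rewrite ffunE eqxx.
  by apply/ffunP => j; rewrite !ffunE; case: eqP => [->|].
rewrite (reindex_inj (inv_inj gK)) /=.
under eq_bigr => p _.
  have -> : upd (upd p.1 i p.2) i (p.1 i) = p.1.
    by apply/ffunP => j; rewrite !ffunE; case: eqP => [->|].
  over.
rewrite -(pair_big xpredT xpredT (fun s (t : T) => F s)) /=.
under eq_bigr => s _ do rewrite sumr_const.
by rewrite sumrMnl mulr_natl.
Qed.

(** Hybrid argument: the factors [m0 i] are exchanged for [m1 i] one coordinate at a time. Averaging
    over the value at [i] by [sum_upd] isolates the factor being exchanged. *)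
Lemma product_le (m0 m1 : I -> T -> R) (G : {ffun I -> T} -> R) :
  (forall i t, 0 <= m0 i t) -> (forall i t, 0 <= m1 i t) ->
  (forall i s, \sum_t m0 i t * G (upd s i t) <= \sum_t m1 i t * G (upd s i t)) ->
  \sum_(s : {ffun I -> T}) (\prod_i m0 i (s i)) * G s
  <= \sum_(s : {ffun I -> T}) (\prod_i m1 i (s i)) * G s.
Proof.
move=> m0p m1p step.
(* [sum_upd] brings in a factor [#|T|] to be cancelled, so an empty alphabet is treated apart. *)
case: (posnP #|T|) => [T0|Tp].
  have [/existsP[i _]|] := boolP [exists i : I, true].
    rewrite !big_pred0 // => s; apply/negP => _; move: T0; by rewrite (cardD1 (s i)) inE.
  rewrite negb_exists => /forallP /= I0.
  apply: ler_sum => s _; rewrite !big_pred0 // => i; by have := I0 i.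
pose m (r : seq I) i := if i \in r then m1 i else m0 i.
have mp r i t : 0 <= m r i t by rewrite /m; case: ifP.
suff H (r : seq I) : uniq r ->
  \sum_(s : {ffun I -> T}) (\prod_i m0 i (s i)) * G s
  <= \sum_(s : {ffun I -> T}) (\prod_i m r i (s i)) * G s.
  have := H (enum I) (enum_uniq _).
  move/le_trans; apply; apply: ler_sum => s _.
  by under eq_bigr => i _ do rewrite /m mem_enum inE.
elim: r => [_|i r IH /= /andP[ir ur]].
  by apply: ler_sum => s _; under [X in _ <= X * _]eq_bigr => i _ do rewrite /m in_nil.
apply: (le_trans (IH ur)).
have Tpos : 0 < #|T|%:R :> R by rewrite ltr0n.
rewrite -(ler_pM2l Tpos) -!(sum_upd i); apply: ler_sum => s _.
have split' r' : \sum_t (\prod_j m r' j (upd s i t j)) * G (upd s i t)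
   = (\prod_(j | j != i) m r' j (s j)) * \sum_t m r' i t * G (upd s i t).
  rewrite mulr_sumr; apply: eq_bigr => t _; rewrite (bigD1 i) //= ffunE eqxx mulrA.
  congr (_ * _); rewrite mulrC; congr (_ * _).
  by apply: eq_bigr => j /negPf ji; rewrite ffunE ji.
rewrite !split'.
have -> : \prod_(j | j != i) m r j (s j) = \prod_(j | j != i) m (i :: r) j (s j).
  by apply: eq_bigr => j /negPf ji; rewrite /m inE ji.
apply: ler_wpM2l; first by apply: prodr_ge0 => j _.
by rewrite /m (negPf ir) mem_head; apply: step.
Qed.

End ProductComparison.

(** The image of a product measure under a coordinatewise map is the product of the image
    measures. *)
Lemma sum_pushforward (R : comNzRingType) (I T T' : finType) (phi : T' -> T)
    (m : I -> T' -> R) (G : {ffun I -> T} -> R) :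
  \sum_(s : {ffun I -> T'}) (\prod_i m i (s i)) * G [ffun i => phi (s i)]
  = \sum_(s : {ffun I -> T}) (\prod_i \sum_(t | phi t == s i) m i t) * G s.
Proof.
rewrite (partition_big (fun s : {ffun I -> T'} => [ffun i => phi (s i)]) xpredT) //=.
apply: eq_bigr => s _.
rewrite (bigA_distr_big_dep _ (fun i t => m i t)) mulr_suml.
apply: eq_big => [s'|s' /eqP -> //].
apply/eqP/familyP => [<- i|H]; first by rewrite ffunE; exact: eqxx.
by apply/ffunP => i; rewrite ffunE; apply/eqP; exact: H.
Qed.

(** Two models with different states per coordinate are compared after both are read in the common
    alphabet [T]. This serves for unions of random sets and for colourings. *)
Lemma product_map_le (R : realFieldType) (I T T0 T1 : finType)
    (phi0 : T0 -> T) (phi1 : T1 -> T) (m0 : T0 -> R) (m1 : T1 -> R)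
    (G : {ffun I -> T} -> R) :
  (forall t, 0 <= m0 t) -> (forall t, 0 <= m1 t) ->
  (forall i s, \sum_t m0 t * G (upd s i (phi0 t))
            <= \sum_t m1 t * G (upd s i (phi1 t))) ->
  \sum_(s : {ffun I -> T0}) (\prod_i m0 (s i)) * G [ffun i => phi0 (s i)]
  <= \sum_(s : {ffun I -> T1}) (\prod_i m1 (s i)) * G [ffun i => phi1 (s i)].
Proof.
move=> m0p m1p step.
rewrite (sum_pushforward phi0 (fun=> m0)) (sum_pushforward phi1 (fun=> m1)).
apply: (product_le (m0 := fun (_ : I) t => \sum_(u | phi0 u == t) m0 u)
                   (m1 := fun (_ : I) t => \sum_(u | phi1 u == t) m1 u)) =>
  [_ t|_ t|i s]; [exact: sumr_ge0|exact: sumr_ge0|].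
have pf (U : finType) (phi : U -> T) (m : U -> R) :
    \sum_t (\sum_(u | phi u == t) m u) * G (upd s i t)
  = \sum_u m u * G (upd s i (phi u)).
  rewrite [RHS](partition_big phi xpredT) //=; apply: eq_bigr => t _.
  by rewrite mulr_suml; apply: eq_bigr => u /eqP ->.
by rewrite !pf.
Qed.

(** * The Park-Pham argument *)

Section RandomSubset.
Variables (R : realFieldType) (Y : finType).
Implicit Types (W U S T Z : {set Y}) (H : {set {set Y}}) (rho w : R).

Definition binom_prob rho W : R := \prod_y (if y \in W then rho else 1 - rho).

Lemma binom_prob_ge0 rho W : 0 <= rho <= 1 -> 0 <= binom_prob rho W.
Proof.
by move=> /andP[r0 r1]; apply: prodr_ge0 => y _; case: ifP; rewrite ?subr_ge0.
Qed.

Lemma sum_binom_prob rho : \sum_W binom_prob rho W = 1.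
Proof.
transitivity (\prod_(y : Y) (rho + (1 - rho))).
  by rewrite bigA_distr; apply: eq_bigl => W; rewrite inE.
by rewrite big1 // => y _; rewrite subrKC.
Qed.

Lemma sum_binom_prob_mem rho y :
  \sum_W binom_prob rho W * (y \in W)%:R = rho.
Proof.
(* Deleting the weight of absence at [y] encodes the indicator of [y \in W]. *)
transitivity (\prod_z (rho + (if z == y then 0 else 1 - rho))).
  rewrite bigA_distr; apply: eq_big => [W|W _]; first by rewrite inE.
  rewrite /binom_prob.
  rewrite (bigD1 y) //= [RHS](bigD1 y) //= eqxx.
  case: ifP => yW; rewrite /= ?mulr1 ?mulr0 ?mul0r //.
  by congr (_ * _); apply: eq_bigr => z /negPf ->.
rewrite (bigD1 y) //= eqxx addr0 big1 ?mulr1 // => z /negPf ->.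
by rewrite subrKC.
Qed.

(** Each point of [U] contributes [(1 - rho) * rho] on the left and [rho] on the right. This pays
    for passing from [W] to [W :|: U] in the cost estimate. *)
Lemma binom_prob_disjointU rho W U : 0 <= rho <= 1 -> [disjoint U & W] ->
  binom_prob rho W * rho ^+ #|U| <= binom_prob rho (W :|: U).
Proof.
move=> /andP[r0 r1] dUW.
have -> : rho ^+ #|U| = \prod_y (if y \in U then rho else 1).
  by rewrite -big_mkcond /= prodr_const.
rewrite /binom_prob -big_split /=; apply: ler_prod => y _; rewrite inE.
have := disjointFr dUW (x := y).
case: (y \in U) => [/(_ isT) ->|_]; rewrite ?orbF ?mulr1 /=.
  by rewrite mulr_ge0 ?subr_ge0 //= ler_piMl // lerBlDr lerDl.
by case: (y \in W); rewrite ?subr_ge0 lexx ?r0 ?r1.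
Qed.

Lemma sum_binom_prob0 (F : {set Y} -> R) :
  \sum_W binom_prob 0 W * F W = F set0.
Proof.
rewrite (bigD1 set0) //= [X in _ + X]big1 ?addr0 => [|W].
  by rewrite /binom_prob big1 ?mul1r // => y _; rewrite inE subr0.
by case/set0Pn => y yW; rewrite /binom_prob (bigD1 y) //= yW !mul0r.
Qed.

Lemma sum_set_ffun (F : {set Y} -> R) :
  \sum_W F W = \sum_(s : {ffun Y -> bool}) F [set y | s y].
Proof.
rewrite (reindex (fun s : {ffun Y -> bool} => [set y | s y])) //=.
exists (fun W => [ffun y => y \in W]) => s _.
  by apply/ffunP => y; rewrite ffunE inE.
by apply/setP => y; rewrite inE ffunE.
Qed.

Lemma sum_set2_ffun (F : {set Y} -> {set Y} -> R) :
  \sum_W \sum_Z F W Z =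
  \sum_(s : {ffun Y -> bool * bool}) F [set y | (s y).1] [set y | (s y).2].
Proof.
rewrite pair_big /= (reindex (fun s : {ffun Y -> bool * bool} =>
  ([set y | (s y).1], [set y | (s y).2]))) //=.
exists (fun p : {set Y} * {set Y} => [ffun y => (y \in p.1, y \in p.2)]) => [s _|[W Z] _].
  by apply/ffunP => y; rewrite ffunE !inE; case: (s y).
by congr pair; apply/setP => y; rewrite inE ffunE.
Qed.

(** Sprinkling: the union of independent sets of densities [r1] and [r2] has density
    [r1 + r2 - r1 * r2], at most [r1 + r2], and [F] is decreasing. *)
Lemma binom_probU_le r1 r2 (F : {set Y} -> R) :
    0 <= r1 -> 0 <= r2 -> r1 + r2 <= 1 ->
    {homo F : W Z / W \subset Z >-> W >= Z} ->
  \sum_W binom_prob (r1 + r2) W * F W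
  <= \sum_W binom_prob r1 W * \sum_Z binom_prob r2 Z * F (W :|: Z).
Proof.
move=> r1p r2p r12 Fdec.
under [leRHS]eq_bigr => W _ do rewrite mulr_sumr.
rewrite sum_set2_ffun sum_set_ffun.
pose ber r (b : bool) : R := if b then r else 1 - r.
pose G (s : {ffun Y -> bool}) := F [set y | s y].
rewrite (eq_bigr (fun s : {ffun Y -> bool} =>
  (\prod_y ber (r1 + r2) (s y)) * G [ffun y => idfun (s y)])); last first.
  move=> s _; congr (_ * F _); last by apply/setP => y; rewrite !inE ffunE.
  by apply: eq_bigr => y _; rewrite inE.
rewrite [leRHS](eq_bigr (fun s : {ffun Y -> bool * bool} =>
  (\prod_y (ber r1 (s y).1 * ber r2 (s y).2))
   * G [ffun y => (fun b => b.1 || b.2) (s y)])); last first.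
  move=> s _; rewrite mulrA big_split; congr (_ * _ * F _).
  - by apply: eq_bigr => y _; rewrite inE.
  - by apply: eq_bigr => y _; rewrite inE.
  - by apply/setP => y; rewrite !inE ffunE.
have berp r b : 0 <= r <= 1 -> 0 <= ber r b.
  by case/andP; case: b; rewrite /ber //= subr_ge0.
apply: (product_map_le (phi0 := idfun) (phi1 := fun b => b.1 || b.2)
  (m0 := ber (r1 + r2)) (m1 := fun b => ber r1 b.1 * ber r2 b.2)).
- by move=> t; apply: berp; rewrite addr_ge0.
- by move=> t; apply: mulr_ge0; apply: berp; lra.
move=> y s.
rewrite big_bool -(pair_big xpredT xpredT (fun a b =>
  ber r1 a * ber r2 b * G (upd s y (a || b)))) /= !big_bool /= /ber.
have : G (upd s y true) <= G (upd s y false).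
  by apply: Fdec; apply/subsetP => z; rewrite !inE !ffunE; case: eqP.
move: (G _) (G _) => g0 g1 g.
rewrite -subr_ge0; set d := (X in 0 <= X).
have -> : d = r1 * r2 * (g0 - g1) by rewrite /d; ring.
by rewrite !mulr_ge0 ?subr_ge0.
Qed.

End RandomSubset.

(** * Minimum fragments and the iteration over rounds *)

Section ParkPham.
Variables (R : realFieldType) (Y : finType).
Implicit Types (W U S T Z : {set Y}) (H : {set {set Y}}) (rho w : R).

(** The edge realising the minimum fragment of Park and Pham. For [S] in [H] the default [S] is
    itself a candidate. *)
Definition fragment_source H S W : {set Y} :=
  [arg min_(S' < S | (S' \in H) && (S' \subset S :|: W)) #|S' :\: W|].

Definition fragment H S W : {set Y} := fragment_source H S W :\: W.

Lemma fragmentP H S W : S \in H ->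
  [/\ fragment_source H S W \in H, fragment_source H S W \subset S :|: W
    & forall S', S' \in H -> S' \subset S :|: W ->
        (#|fragment H S W| <= #|S' :\: W|)%N].
Proof.
move=> SH; rewrite /fragment /fragment_source.
case: arg_minnP => [|S' /andP[S'H S'sub] min]; first by rewrite SH subsetUl.
by split=> // S'' S''H S''sub; apply: min; rewrite S''H.
Qed.

Lemma fragment_sub H S W : S \in H -> fragment H S W \subset S.
Proof.
by case/(fragmentP W) => _ sub _; rewrite /fragment subDset setUC.
Qed.

(** The chosen edge depends on [Z] alone, so that fragments [U] with [W :|: U = Z] can be counted as
    subsets of one set. *)
Definition edge_in H Z : {set Y} := odflt set0 [pick S in H | S \subset Z].

Lemma edge_inP H S Z : S \in H -> S \subset Z ->
  edge_in H Z \in H /\ edge_in H Z \subset Z.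
Proof.
move=> SH SZ; rewrite /edge_in; case: pickP => [S' /andP[]//|/(_ S)].
by rewrite SH SZ.
Qed.

(* Any edge of H inside W :|: U, where U is the fragment of S, is itself a
   competitor for S, so by minimality it contains U. *)
Lemma fragment_sub_edge_in H S W (U := fragment H S W) : S \in H ->
  edge_in H (W :|: U) \in H /\ U \subset edge_in H (W :|: U).
Proof.
move=> SH; have [S'H S'sub min] := fragmentP W SH.
have S'WU : fragment_source H S W \subset W :|: U.
  by rewrite /U /fragment setDE setUIr setUCr setIT subsetUr.
have [EH EWU] := edge_inP S'H S'WU; split=> //.
have EU : edge_in H (W :|: U) :\: W \subset U by rewrite subDset.
have WUsub : W :|: U \subset S :|: W.
  by rewrite setUC setSU // /U fragment_sub.
have leU := min _ EH (subset_trans EWU WUsub).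
have /eqP defU : edge_in H (W :|: U) :\: W == U by rewrite eqEcard EU.
by rewrite -{1}defU subsetDl.
Qed.

Definition large_fragments H W h : {set {set Y}} :=
  [set fragment H S W | S in H & (h <= #|fragment H S W|)%N].

Definition small_fragments H W h : {set {set Y}} :=
  [set fragment H S W | S in H & (#|fragment H S W| < h)%N].

Definition cost w (C : {set {set Y}}) : R := \sum_(U in C) w ^+ #|U|.

(** Double counting by [Z = W :|: U]: the weight of [W] times [w ^+ #|U|] is at most that of [Z]
    times [(w / rho) ^+ h], and [U] is a subset of [edge_in H Z], which leaves at most
    [2 ^ (2 * h) = 4 ^ h] choices. *)
Lemma expected_cost_large H h w rho :
    (forall S, S \in H -> (#|S| < h.*2)%N) -> 0 <= w -> w <= rho ->
    0 < rho <= 1 ->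
  \sum_W binom_prob rho W * cost w (large_fragments H W h)
  <= (4%:R * (w / rho)) ^+ h.
Proof.
move=> Hsize w0 wrho /andP[rho0 rho1].
have rho01 : 0 <= rho <= 1 by rewrite ltW.
have x0 : 0 <= w / rho by rewrite divr_ge0 // ltW.
have x1 : w / rho <= 1 by rewrite ler_pdivrMr // mul1r.
pose ok U Z := [&& edge_in H Z \in H, U \subset edge_in H Z & (h <= #|U|)%N].
pose F Z U := if ok U Z then binom_prob rho Z * (w / rho) ^+ h else 0.
have F0 Z U : 0 <= F Z U.
  by rewrite /F; case: ifP => // _; rewrite mulr_ge0 ?binom_prob_ge0 ?exprn_ge0.
apply: (@le_trans _ _ (\sum_(W : {set Y}) \sum_(U : {set Y} | [disjoint U & W])
    F (W :|: U) U)).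
  apply: ler_sum => W _; rewrite /cost mulr_sumr.
  rewrite [leLHS]big_mkcond [leRHS]big_mkcond /=; apply: ler_sum => U _.
  case: ifP => [/imsetP[S]|_]; last by case: ifP.
  rewrite inE => /andP[SH hU defU].
  have [EH UE] := fragment_sub_edge_in W SH; rewrite -defU in hU EH UE.
  have dUW : [disjoint U & W].
    by rewrite defU -setI_eq0 /fragment setDE -setIA (setIC (~: W)) setICr setI0.
  rewrite dUW /F /ok EH UE hU /=.
  apply: (@le_trans _ _ (binom_prob rho W * rho ^+ #|U| * (w / rho) ^+ #|U|)).
    rewrite -mulrA -exprMn mulrCA divff ?gt_eqF // mulr1 lexx //.
  apply: ler_pM; first by rewrite mulr_ge0 ?binom_prob_ge0 ?exprn_ge0 ?(ltW rho0).
  - exact: exprn_ge0.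
  - exact: binom_prob_disjointU.
  - by apply: ler_wiXn2l.
rewrite (exchange_big_dep xpredT) //=.
have -> : \sum_(U : {set Y}) \sum_(W : {set Y} | [disjoint U & W]) F (W :|: U) U
        = \sum_(U : {set Y}) \sum_(Z : {set Y} | U \subset Z) F Z U.
  apply: eq_bigr => U _.
  (* For [U] disjoint from [W], the pair [(W, U)] is recovered from [(Z, U)] by [W = Z :\: U]. *)
  rewrite (reindex_onto (fun Z => Z :\: U) (fun W => W :|: U)) /=.
    apply: eq_big => [Z|Z].
      rewrite setDE setUIl (setUC (~: U)) setUCr setIT -setI_eq0 setIC -setIA.
      by rewrite (setIC _ U) setICr setI0 eqxx /= (sameP eqP setUidPl).
    case/andP => _ /eqP ZU; by rewrite ZU.
  move=> W; rewrite -setI_eq0 => /eqP UW.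
  by rewrite setDUl setDv setU0; apply/setDidPl; rewrite -setI_eq0 setIC UW.
rewrite (exchange_big_dep xpredT) //=.
apply: (@le_trans _ _ (\sum_Z binom_prob rho Z * (4%:R * (w / rho)) ^+ h)); last first.
  by rewrite -mulr_suml sum_binom_prob mul1r.
apply: ler_sum => Z _.
apply: (@le_trans _ _ (\sum_(U | ok U Z) binom_prob rho Z * (w / rho) ^+ h)).
  rewrite [leRHS]big_mkcond [leLHS]big_mkcond /=; apply: ler_sum => U _.
  by rewrite /F; case: ifP => // _; case: ifP => // _; rewrite mulr_ge0 ?binom_prob_ge0 ?exprn_ge0.
rewrite sumr_const -mulrnAr; apply: ler_wpM2l; first exact: binom_prob_ge0.
rewrite [leRHS]exprMn -mulr_natl; apply: ler_wpM2r; first exact: exprn_ge0.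
rewrite -natrX ler_nat.
case: (boolP (edge_in H Z \in H)) => EH; last first.
  by rewrite eq_card0 // => U; rewrite unfold_in /= /ok (negPf EH).
apply: (@leq_trans #|powerset (edge_in H Z)|).
  apply: subset_leq_card; apply/subsetP => U; rewrite unfold_in /= => /andP[UE _].
  by rewrite inE.
rewrite card_powerset -[4%N]/(2 ^ 2)%N -expnM leq_exp2l // mul2n.
by apply: ltnW; apply: Hsize.
Qed.

Definition contains_edge H W := [exists S in H, S \subset W].

Definition fail_prob rho H : R :=
  \sum_W binom_prob rho W * (~~ contains_edge H W)%:R.

(** A fragment is [S' :\: W] for an edge [S'], so adding it to [W] completes [S']. *)
Lemma contains_small_fragments H W Z h :
  contains_edge (small_fragments H W h) Z -> contains_edge H (W :|: Z).
Proof.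
case/existsP => T /andP[/imsetP[S]]; rewrite inE => /andP[SH _] -> sub.
have [S'H _ _] := fragmentP W SH; apply/existsP; exists (fragment_source H S W).
by rewrite S'H -subDset.
Qed.

Definition covers (C H : {set {set Y}}) :=
  forall S, S \in H -> exists2 U, U \in C & U \subset S.

Lemma fail_prob_le1 rho H : 0 <= rho <= 1 -> fail_prob rho H <= 1.
Proof.
move=> r01; rewrite -(sum_binom_prob Y rho); apply: ler_sum => W _.
by rewrite ler_piMr ?binom_prob_ge0 ?lern1 //; case: contains_edge.
Qed.

Lemma fail_prob_ge0 rho H : 0 <= rho <= 1 -> 0 <= fail_prob rho H.
Proof.
by move=> r01; apply: sumr_ge0 => W _; rewrite mulr_ge0 ?binom_prob_ge0.
Qed.

Lemma cost_ge0 w C : 0 <= w -> 0 <= cost w C.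
Proof. by move=> w0; apply: sumr_ge0 => U _; apply: exprn_ge0. Qed.

Lemma costU_le w C D : 0 <= w -> cost w (C :|: D) <= cost w C + cost w D.
Proof.
move=> w0; rewrite /cost [X in _ <= X + _]big_mkcond [X in _ <= _ + X]big_mkcond.
rewrite -big_split [leLHS]big_mkcond /=.
apply: ler_sum => U _; rewrite inE; have := exprn_ge0 #|U| w0.
by case: (U \in C); case: (U \in D) => /=; rewrite ?addr0 ?add0r // lerDl.
Qed.

(** Induction on the number of rounds, the round with the largest fragments being exposed first.
    Keeping the lower bound [a] general lets each round lower it by the cost of its large
    fragments. *)
Theorem park_pham (L : nat -> R) w J H a :
    (forall S, S \in H -> (#|S| < 2 ^ J)%N) -> 0 < w -> (forall j, 1 <= L j) ->
    \sum_(j < J) L j * w <= 1 ->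
    (forall C, covers C H -> a <= cost w C) ->
  a * fail_prob (\sum_(j < J) L j * w) H <= \sum_(j < J) (4%:R / L j) ^+ (2 ^ j).
Proof.
move=> Hsize w0 L1.
elim: J H a Hsize => [|J IH] H a Hsize.
  rewrite !big_ord0 => _ cov; rewrite /fail_prob sum_binom_prob0.
  (* Without edges the empty cover forces [a <= 0]; otherwise the edge has size below [2 ^ 0], so it
     is empty and never missed. *)
  have [H0|[S SH]] := set_0Vmem H.
    rewrite mulr_le0_ge0 //.
    have -> : 0 = cost w set0 by rewrite /cost big_set0.
    by apply: cov => S SH; have := SH; rewrite H0 inE.
  have := Hsize _ SH; rewrite ltnS leqn0 cards_eq0 => /eqP S0.
  suff -> : contains_edge H set0 by rewrite mulr0.
  by apply/existsP; exists S; rewrite SH S0 sub0set.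
rewrite !big_ord_recr /= => sumle1 cov.
set r := \sum_(j < J) L j * w in sumle1 IH *.
set E := \sum_(j < J) (4%:R / L j) ^+ (2 ^ j) in IH *.
have Lw0 j : 0 < L j * w by rewrite mulr_gt0 // (lt_le_trans ltr01).
have r0 : 0 <= r by apply: sumr_ge0 => j _; exact: ltW.
have rJ : 0 < L J * w <= 1 by rewrite Lw0 /=; lra.
have rJ' : 0 <= L J * w <= 1 by rewrite ltW //=; lra.
have r01 : 0 <= r <= 1 by rewrite r0 /=; have := Lw0 J; lra.
pose h := (2 ^ J)%N.
(* The large fragments complete any cover of the small ones to a cover of [H], so the induction
   hypothesis applies to the small fragments with [a] minus the cost of the large ones. *)
have step W : a * fail_prob r (small_fragments H W h)
              <= E + cost w (large_fragments H W h).
  have : (a - cost w (large_fragments H W h)) * fail_prob r (small_fragments H W h) <= E.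
    apply: IH => [S /imsetP[S']||C covC].
  - by rewrite inE => /andP[_ ?] ->.
  - by have := Lw0 J; lra.
  - rewrite lerBlDl; apply: le_trans (costU_le _ _ (ltW w0)).
    apply: cov => S SH.
    case: (leqP h #|fragment H S W|) => hS.
      exists (fragment H S W); last exact: fragment_sub.
      by rewrite inE; apply/orP; left; apply/imsetP; exists S; rewrite ?inE ?SH.
    have [|U UC UT] := covC (fragment H S W).
      by apply/imsetP; exists S; rewrite ?inE ?SH.
    exists U; first by rewrite inE UC orbT.
    exact: subset_trans UT (fragment_sub _ SH).
  rewrite mulrBl lerBlDr => /le_trans; apply; rewrite lerD2l.
  by apply: ler_piMr; [exact/cost_ge0/ltW|exact: fail_prob_le1].
have E0 : 0 <= E.
  apply: sumr_ge0 => j _; apply: exprn_ge0; apply: divr_ge0 => //.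
  exact: le_trans ler01 (L1 j).
have cost_bound :
    \sum_W binom_prob (L J * w) W * cost w (large_fragments H W h)
    <= (4%:R / L J) ^+ h.
  have := @expected_cost_large H h w (L J * w).
  rewrite invfM (mulrCA w) divff ?gt_eqF // mulr1; apply => //.
  - by move=> S SH; rewrite -mul2n -expnS; apply: Hsize.
  - exact: ltW.
  - by rewrite ler_peMl // ltW.
(* Multiplication by [a] preserves inequalities only for positive [a]; otherwise the left side is at
   most 0. *)
have [a0|a0] := lerP a 0.
  apply: (@le_trans _ _ 0).
    by apply: mulr_le0_ge0 => //; apply: fail_prob_ge0; lra.
  rewrite addr_ge0 //; apply: le_trans cost_bound.
  by apply: sumr_ge0 => W _; apply: mulr_ge0; [exact: binom_prob_ge0|exact/cost_ge0/ltW].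
apply: (@le_trans _ _ (\sum_W binom_prob (L J * w) W
                        * (a * fail_prob r (small_fragments H W h)))).
  under eq_bigr => W _ do rewrite mulrCA.
  rewrite -mulr_sumr ler_pM2l // /fail_prob addrC.
  apply: (le_trans (binom_probU_le _ _ _ _)) => //; first by case/andP: rJ'.
  - by rewrite addrC.
  - move=> W Z WZ; rewrite ler_nat.
    case: (boolP (contains_edge H Z)) => // nZ; case: (boolP (contains_edge H W)) => //.
    case/existsP => S /andP[SH SW]; case/negP: nZ.
    by apply/existsP; exists S; rewrite SH (subset_trans SW WZ).
  apply: ler_sum => W _; apply: ler_wpM2l; first exact: binom_prob_ge0.
  apply: ler_sum => Z _; apply: ler_wpM2l; first exact: binom_prob_ge0.
  rewrite ler_nat; case: (boolP (contains_edge H _)) => // nc.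
  case: (boolP (contains_edge (small_fragments H W h) Z)) => //.
  by move/contains_small_fragments; rewrite (negPf nc).
apply: (@le_trans _ _ (\sum_W binom_prob (L J * w) W
                        * (E + cost w (large_fragments H W h)))).
  by apply: ler_sum => W _; apply: ler_wpM2l; rewrite ?binom_prob_ge0.
under eq_bigr => W _ do rewrite mulrDr.
by rewrite big_split /= -mulr_suml sum_binom_prob mul1r lerD2l.
Qed.

End ParkPham.

(** * One colour per edge *)

Section UniqueColour.
Variables (R : realFieldType) (E Q : finType).

Definition coloured_edges (s : {ffun E -> option Q}) : {set E * Q} :=
  [set y | s y.1 == Some y.2].

(** In the model of independent coloured edges an edge may carry any set of colours. *)
Definition fibre_set (s : {ffun E -> {set Q}}) : {set E * Q} :=
  [set y | y.2 \in s y.1].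

Lemma sum_binom_prob_fibre (rho : R) (F : {set E * Q} -> R) :
  \sum_W binom_prob rho W * F W =
  \sum_(s : {ffun E -> {set Q}}) (\prod_e binom_prob rho (s e)) * F (fibre_set s).
Proof.
rewrite (reindex fibre_set) /=.
  apply: eq_bigr => s _; congr (_ * _).
  rewrite pair_big /binom_prob /=; apply: eq_bigr => y _; by rewrite inE.
exists (fun W : {set E * Q} => [ffun e => [set c | (e, c) \in W]]) => [s _|W _].
  by apply/ffunP => e; rewrite ffunE; apply/setP => c; rewrite !inE.
by apply/setP => -[e c]; rewrite inE ffunE inE.
Qed.

(** Edge by edge, with the other edges fixed, a single random colour is replaced by a random set of
    colours. The failure probability is linear in the first model and bounded below by the union
    bound in the second. *)
Lemma unique_colour_fail_le (p rho : R) (H : {set {set E * Q}}) :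
    (0 < #|Q|)%N -> 0 <= p <= 1 -> 0 <= rho <= 1 -> rho <= p / #|Q|%:R ->
    (forall S, S \in H -> {in S &, injective fst}) ->
  \sum_(s : {ffun E -> option Q})
     (\prod_e (if s e is Some _ then p / #|Q|%:R else 1 - p))
     * (~~ contains_edge H (coloured_edges s))%:R
  <= fail_prob rho H.
Proof.
move=> Q0 p01 rho01 rhop Hinj.
pose ind W : R := (~~ contains_edge H W)%:R.
pose phi (o : option Q) := if o is Some c then [set c] else set0.
pose m0 (o : option Q) : R := if o is Some _ then p / #|Q|%:R else 1 - p.
rewrite /fail_prob (sum_binom_prob_fibre rho ind).
pose G s := ind (fibre_set s).
rewrite (eq_bigr (fun s : {ffun E -> option Q} =>
   (\prod_e m0 (s e)) * G [ffun e => phi (s e)])); last first.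
  move=> s _; congr (_ * (~~ contains_edge H _)%:R); apply/setP => y.
  rewrite !inE ffunE /phi; case: (s y.1) => [c|]; rewrite inE //.
  by rewrite (inj_eq Some_inj) eq_sym.
rewrite [leRHS](eq_bigr (fun s : {ffun E -> {set Q}} =>
   (\prod_e binom_prob rho (s e)) * G [ffun e => id (s e)])); last first.
  move=> s _; congr (_ * G _); by apply/ffunP => e; rewrite ffunE.
apply: (product_map_le (phi0 := phi) (phi1 := id) (m0 := m0) (m1 := binom_prob rho)).
- case=> [c|] /=; case/andP: p01 => p0 p1; last by rewrite subr_ge0.
  by rewrite divr_ge0.
- by move=> C; apply: binom_prob_ge0.
move=> e s; set g := fun C => G (upd s e C).
have g_anti (C D : {set Q}) : C \subset D -> g D <= g C.
  move=> CD; rewrite ler_nat.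
  case: (boolP (contains_edge H (fibre_set (upd s e C)))) => /=;
    last by rewrite leq_b1.
  case/existsP => S /andP[SH SC].
  suff -> : contains_edge H (fibre_set (upd s e D)) by [].
  apply/existsP; exists S; rewrite SH; apply: subset_trans SC _.
  apply/subsetP => y; rewrite !inE !ffunE; case: eqP => // _; exact: (subsetP CD).
(* [d c] is 1 if colour [c] on [e] turns failure into success, and 0 otherwise. *)
pose d c := g set0 - g [set c].
have d0 c : 0 <= d c by rewrite subr_ge0; apply: g_anti; exact: sub0set.
have g0 C : 0 <= g C by apply: ler0n.
(* An edge of H meets the fibre over e at most once, so it cannot use two
   elements of C. *)
have gC (C : {set Q}) : g set0 - \sum_c (c \in C)%:R * d c <= g C.
  have sum0 : 0 <= \sum_c (c \in C)%:R * d c by apply: sumr_ge0 => c _; rewrite mulr_ge0.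
  have [c0 /andP[c0C gc0]|Cg] := pickP [pred c | (c \in C) && (g [set c] == 0)].
    apply: (@le_trans _ _ 0) => //; rewrite subr_le0 (bigD1 c0) //= c0C mul1r.
    have -> : d c0 = g set0 by rewrite /d (eqP gc0) subr0.
    rewrite lerDl; apply: sumr_ge0 => c _; by rewrite mulr_ge0.
  apply: (@le_trans _ _ (g set0)); first by rewrite lerBlDr lerDl.
  rewrite ler_nat.
  case: (boolP (contains_edge H (fibre_set (upd s e C)))) => /=;
    last by rewrite leq_b1.
  case/existsP => S /andP[SH SC].
  suff : contains_edge H (fibre_set (upd s e set0)) by move=> ->.
  apply/existsP; exists S; rewrite SH; apply/subsetP => -[e1 c1] yS.
  have := subsetP SC _ yS; rewrite !inE !ffunE /=; case: eqP => // e1e c1C.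
  have := Cg c1; rewrite /= c1C /= pnatr_eq0 eqb0 negbK => /negbT/negP[].
  apply/existsP; exists S; rewrite SH; apply/subsetP => -[e2 c2] yS2.
  have := subsetP SC _ yS2; rewrite !inE !ffunE /=; case: eqP => // e2e _.
  have := Hinj _ SH _ _ yS2 yS; rewrite /= e1e e2e => /(_ erefl) [->].
  by rewrite set11.
(* The possible colours of [e] are disjoint events of probability [p / #|Q|], so this expectation is
   exact. *)
have -> : \sum_t m0 t * G (upd s e (phi t)) = g set0 - p / #|Q|%:R * \sum_c d c.
  rewrite (bigID (fun o : option Q => isSome o)) /= addrC.
  have -> : \sum_(o | ~~ isSome o) m0 o * G (upd s e (phi o)) = (1 - p) * g set0.
    by rewrite (bigD1 None) //= big_pred0 ?addr0 // => -[].
  have -> : \sum_(o | isSome o) m0 o * G (upd s e (phi o))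
          = \sum_c p / #|Q|%:R * g [set c].
    rewrite (reindex_onto Some (odflt (xchoose (card_gt0P Q0)))) /=; last by case.
    by apply: eq_bigl => c; rewrite eqxx.
  rewrite -mulr_sumr /d sumrB sumr_const -mulr_natr.
  by field; rewrite pnatr_eq0 -lt0n.
apply: (@le_trans _ _ (g set0 - rho * \sum_c d c)).
  by rewrite lerD2l lerN2 ler_wpM2r // sumr_ge0.
apply: (@le_trans _ _ (\sum_C binom_prob rho C * (g set0 - \sum_c (c \in C)%:R * d c))).
  under [leRHS]eq_bigr => C _ do rewrite mulrBr.
  rewrite [leRHS]sumrB -mulr_suml sum_binom_prob mul1r lerD2l lerN2.
  under eq_bigr => C _ do rewrite mulr_sumr.
  rewrite exchange_big /= mulr_sumr; apply: ler_sum => c _.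
  under eq_bigr => C _ do rewrite mulrA.
  by rewrite -mulr_suml sum_binom_prob_mem.
by apply: ler_sum => C _; apply: ler_wpM2l; rewrite ?binom_prob_ge0.
Qed.

End UniqueColour.

(** * Counting rainbow cycles with few inversions *)

Local Open Scope nat_scope.

(** Off [P], a pinned injection is an injection of [#|A| - #|P|] points into the [#|B| - #|P|]
    values not taken on [P]. *)
Lemma card_inj_pinned (A B : finType) (P : {set A}) (g : A -> B) :
  #|[set f : {ffun A -> B} | injectiveb f && [forall x in P, f x == g x]]|
    * #|B| ^_ #|P| <= #|B| ^_ #|A|.
Proof.
set X := finset _.
have [->|[f0]] := set_0Vmem X; first by rewrite cards0.
rewrite inE => /andP[/injectiveP f0inj /forall_inP f0P].
have ginj : {in P &, injective g}.
  by move=> x y /f0P/eqP <- /f0P/eqP <-; apply: f0inj.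
pose D := {x : A | x \notin P}.
pose r (f : {ffun A -> B}) : {ffun D -> B} := [ffun x => f (val x)].
have r_inj : {in X &, injective r}.
  move=> f f' ; rewrite !inE => /andP[_ /forall_inP fP] /andP[_ /forall_inP f'P] E.
  apply/ffunP => x; have [xP|xP] := boolP (x \in P).
    by rewrite (eqP (fP _ xP)) (eqP (f'P _ xP)).
  by have /ffunP/(_ (Sub x xP)) := E; rewrite !ffunE.
rewrite -(card_in_imset r_inj).
have sub : r @: X \subset
    [set f in ffun_on [pred c | c \notin g @: P] | injectiveb (f : {ffun D -> B})].
  apply/subsetP => _ /imsetP[f fX ->]; move: fX.
  rewrite !inE => /andP[/injectiveP finj /forall_inP fP]; apply/andP; split.
    apply/ffun_onP => x; rewrite ffunE inE; apply/imsetP => -[y yP E].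
    have /finj xy : f (val x) = f y by rewrite E (eqP (fP _ yP)).
    by have := valP x; rewrite xy yP.
  by apply/injectiveP => x y; rewrite !ffunE => /finj/val_inj.
have := subset_leq_card sub; rewrite card_inj_ffuns_on card_sig.
have -> : #|[pred c | c \notin g @: P]| = #|B| - #|P|.
  rewrite -(card_in_imset ginj) -(cardC (mem (g @: P))) addKn.
  by apply: eq_card => c; rewrite !inE.
have -> : #|[pred x | x \notin P]| = #|A| - #|P|.
  by rewrite -(cardC (mem P)) addKn; apply: eq_card => c; rewrite !inE.
move=> le; apply: leq_trans (leq_mul le (leqnn _)) _.
have PA : #|P| <= #|A| by apply: max_card.
have AB : #|A| <= #|B| by apply: leq_card f0inj.
(* The factor [(#|B| - #|A|)!] turns the falling factorials into factorials. *)
have key : (#|B| - #|P|) ^_ (#|A| - #|P|) * #|B| ^_ #|P| * (#|B| - #|A|)`! =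
    #|B| ^_ #|A| * (#|B| - #|A|)`!.
  rewrite ffact_fact // -(ffact_fact (leq_trans PA AB)) mulnAC mulnC; congr (_ * _).
  by rewrite -(ffact_fact (leq_sub2r #|P| AB)) subnBA // subnK //; exact: leq_trans PA AB.
by rewrite -(leq_pmul2r (fact_gt0 (#|B| - #|A|))) key.
Qed.

(** * Permutations preserving blocks, with prescribed successors *)

Definition block_perms (V J : finType) (blk : V -> J) : {set {perm V}} :=
  [set s : {perm V} | [forall x, blk (s x) == blk x]].

Lemma foldr_muln_image (J : finType) (F : J -> nat) :
  foldr muln 1 [seq F i | i : J] = \prod_i F i.
Proof. by rewrite foldrE big_map big_enum. Qed.

(** Permutations of the classes, chosen independently, glue to distinct permutations preserving all
    classes. *)
Lemma card_block_perms_ge (V J : finType) (blk : V -> J) :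
  \prod_i #|[set x | blk x == i]|`! <= #|block_perms blk|.
Proof.
pose cls i := [set x | blk x == i].
pose fam := family (fun i => mem (perm_on (cls i)) : pred {perm V}).
have tau_blk (t : {ffun J -> {perm V}}) : t \in fam ->
    forall x, blk (t (blk x) x) = blk x.
  move=> /familyP H x; have := perm_closed x (H (blk x)).
  by rewrite !inE eqxx => /eqP.
have glue_inj (t : {ffun J -> {perm V}}) : t \in fam ->
    injective (fun x => t (blk x) x).
  move=> tf x y E; have := congr1 blk E; rewrite !tau_blk // => bxy.
  by move: E; rewrite bxy => /perm_inj.
(* The identity is a default; for [t] in [fam] the glued map is injective. *)
pose glue (t : {ffun J -> {perm V}}) : {perm V} :=
  if injectiveP (fun x => t (blk x) x) is ReflectT h then perm h else 1%g.
have glueE t x : t \in fam -> glue t x = t (blk x) x.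
  rewrite /glue => tf; case: injectiveP => [h|[]]; first by rewrite permE.
  exact: glue_inj.
have -> : \prod_i #|[set x | blk x == i]|`! = #|fam|.
  rewrite card_family foldr_muln_image; apply: eq_bigr => i _.
  by rewrite -card_perm; apply: eq_card.
rewrite -(card_in_imset (f := glue)) => [|t u tf uf E].
  apply: subset_leq_card; apply/subsetP => _ /imsetP[t tf ->].
  by rewrite inE; apply/forallP => x; rewrite glueE // tau_blk.
apply/ffunP => i; apply/permP => x; have [<-|bx] := eqVneq (blk x) i.
  by rewrite -!glueE // E.
have out (v : {ffun J -> {perm V}}) : v \in fam -> v i x = x.
  by move=> /familyP/(_ i) vi; apply: (out_perm vi); rewrite inE.
by rewrite !out.
Qed.

Section ConstrainedSuccessors.
Variables (n : nat) (J : finType) (blk : 'I_n.+1 -> J).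
Variables (D : {set 'I_n.+1}) (nx : 'I_n.+1 -> option 'I_n.+1).

(** [nx x] is the prescribed successor of [x], if any, and [D] holds the vertices that may only be
    reached by prescription. *)
Definition may_follow (x y : 'I_n.+1) : bool :=
  if nx x is Some z then y == z else y \notin D.

Definition successor_constrained : {set {perm 'I_n.+1}} :=
  [set s : {perm 'I_n.+1} in block_perms blk | [forall k, may_follow (s k) (s (ordS k))]].

Lemma filter_cat_cons_inj (T : eqType) (a : pred T) (s t t' : seq T) x y :
  a x -> a y -> filter a (s ++ x :: t) = filter a (s ++ y :: t') -> x = y.
Proof.
move=> ax ay; rewrite !filter_cat /= ax ay => /eqP.
by rewrite eqseq_cat // eqxx /= => /eqP[].
Qed.

Definition free_part (s : {perm 'I_n.+1}) (i : J) : seq 'I_n.+1 :=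
  [seq x <- codom s | (blk x == i) && (x \notin D)].

(* Reading the values from left to right, each one is either forced by its
   predecessor or is the next unread element of the free part of its block. *)
Lemma successor_constrained_inj (s t : {perm 'I_n.+1}) :
    s \in successor_constrained -> t \in successor_constrained ->
    (if s ord0 \in D then Some (s ord0) else None)
      = (if t ord0 \in D then Some (t ord0) else None) ->
    (forall i, free_part s i = free_part t i) -> s = t.
Proof.
rewrite !inE => /andP[/forallP sB /forallP sF] /andP[/forallP tB /forallP tF] E0 Efree.
suff H m : forall k : 'I_n.+1, k < m -> s k = t k.
  by apply/permP => k; apply: (H n.+1).
elim: m => // m IH k; rewrite ltnS leq_eqVlt => /orP[/eqP km|]; last exact: IH.
have free_eq : s k \notin D -> t k \notin D -> s k = t k.
  move=> sD tD; have := Efree (blk k); rewrite /free_part /codom /image_mem.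
  rewrite -(cat_take_drop k (enum 'I_n.+1)) !map_cat.
  have -> : drop k (enum 'I_n.+1) = k :: drop k.+1 (enum 'I_n.+1).
    by rewrite (drop_nth k) ?size_enum_ord // nth_ord_enum.
  have -> : [seq s i | i <- take k (enum 'I_n.+1)] = [seq t i | i <- take k (enum 'I_n.+1)].
    apply/eq_in_map => x xk; apply: IH; rewrite -km.
    have : nat_of_ord x \in take k (iota 0 n.+1).
      by rewrite -val_enum_ord -map_take map_f.
    by rewrite take_iota mem_iota add0n leq_min => /and3P[].
  rewrite /= => /filter_cat_cons_inj; apply.
    by rewrite (eqP (sB k)) eqxx.
  by rewrite (eqP (tB k)) eqxx.
have [k0|k0] := posnP k.
  have -> : k = ord0 by apply: val_inj.
  move: E0; have <- : k = ord0 by apply: val_inj.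
  case: ifP => sD; case: ifP => tD //; first by case.
  by move=> _; apply: free_eq; rewrite ?sD ?tD.
have eqp : s (ord_pred k) = t (ord_pred k).
  apply: IH; rewrite -km /=; have -> : (k + n.+1).-1 = k.-1 + n.+1 by lia.
  by rewrite modnDr modn_small; have := ltn_ord k; lia.
have := sF (ord_pred k); have := tF (ord_pred k).
rewrite !ord_predK /may_follow eqp; case: (nx _) => [z /eqP -> /eqP ->//|].
by move=> tD sD; apply: free_eq.
Qed.

(** The sequence is encoded by the order of the free vertices in each block and by its first vertex
    if that lies in [D]: reading starts without a predecessor, which costs the factor [#|D|.+1]. *)
Lemma card_successor_constrained_le :
  #|successor_constrained| <= #|D|.+1 * \prod_i #|[set x | blk x == i] :\: D|`!.
Proof.
pose V := 'I_n.+1.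
pose code (s : {perm V}) : option V * {ffun J -> {bseq n.+1 of V}} :=
  (if s ord0 \in D then Some (s ord0) else None,
   [ffun i => insub_bseq n.+1 (free_part s i)]).
have free_val (s : {perm V}) i : insub_bseq n.+1 (free_part s i) = free_part s i :> seq V.
  rewrite val_insubd ifT // size_filter; apply: leq_trans (count_size _ _) _.
  by rewrite size_codom card_ord.
have code_inj : {in successor_constrained &, injective code}.
  move=> s t sQ tQ [E0 /ffunP Ef]; apply: successor_constrained_inj => // i.
  by have := Ef i; rewrite !ffunE => /(congr1 val) /=; rewrite !free_val.
rewrite -(card_in_imset code_inj).
pose cls i := [set x | blk x == i] :\: D.
pose F i := [pred t : {bseq n.+1 of V} | perm_eq t (enum (cls i))].
pose heads : {set option V} := None |: [set Some x | x in D].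
apply: (@leq_trans #|[predX heads & family F]|).
  apply: subset_leq_card; apply/subsetP => _ /imsetP[s sQ ->].
  rewrite inE /=; apply/andP; split.
    rewrite !inE; case: ifP => //= sD; first by rewrite imset_f // orbT.
  apply/familyP => i; rewrite ffunE inE /= free_val.
  apply: uniq_perm; rewrite ?enum_uniq ?filter_uniq ?codom_uniq //.
    by apply/injectiveP; apply: perm_inj.
  move=> x; have xs : x \in codom s by rewrite -[x](permKV s) codom_f.
  by rewrite mem_filter mem_enum xs !inE andbT andbC.
rewrite cardX card_family foldr_muln_image; apply: leq_mul.
  rewrite cardsU1 (card_imset D Some_inj).
  by rewrite -[#|D|.+1]add1n leq_add2r leq_b1.
apply: leq_prod => i _.
have -> : #|cls i|`! = size (permutations (enum (cls i))).
  by rewrite size_permutations ?enum_uniq // -cardE.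
rewrite cardE -(size_map val); apply: uniq_leq_size.
  by rewrite map_inj_uniq ?enum_uniq //; apply: val_inj.
move=> _ /mapP[t tF ->]; rewrite mem_permutations.
by move: tF; rewrite mem_enum.
Qed.

End ConstrainedSuccessors.

(** * Powers against falling factorials *)

(** Bernoulli's inequality for [(1 - 1 / (m + 1)) ^ k], with denominators cleared. *)
Lemma expSn_bernoulli m k : k <= m.+1 -> m.+1 ^ k * (m.+1 - k) <= m ^ k * m.+1.
Proof.
elim: k => [|k IH] km; first by rewrite !expn0 subn0.
have := leq_mul (leqnn m) (IH (ltnW km)).
rewrite !expnS -!mulnA => le; apply: leq_trans le.
rewrite (mulnCA m.+1) (mulnCA m) leq_mul2l; apply/orP; right.
rewrite !mulnBr; nia.
Qed.

(** The exponent splits into two parts of at most [(m + 1) / 2], and Bernoulli's inequality gives a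
    factor 2 for each. *)
Lemma expSn_le4 m d : d <= m -> m.+1 ^ d <= 4 * m ^ d.
Proof.
move=> dm.
have half k : k.*2 <= m.+1 -> m.+1 ^ k <= 2 * m ^ k.
  move=> km; rewrite -(leq_pmul2r (ltn0Sn m)) -mulnA.
  apply: leq_trans (leq_mul (leqnn 2) (expSn_bernoulli _)); last by lia.
  by rewrite mulnCA leq_mul2l; apply/orP; right; lia.
rewrite -(odd_double_half d) -addnn addnA !expnD.
have h1 := half d./2; have h2 := half (odd d + d./2).
rewrite -expnD -[X in _ <= 4 * (X * _)]expnD.
have := leq_mul (h2 _) (h1 _); rewrite !mulnA (mulnAC 2) -!mulnA; apply; lia.
Qed.

Lemma ffact_ge n d : d <= n -> n ^ d <= 4 ^ d * n ^_ d.
Proof.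
elim: d n => [|d IH] [|n] // dn.
rewrite ffactSS (expnS n.+1) (expnS 4) mulnCA leq_mul2l /= -mulnA.
by apply: leq_trans (expSn_le4 (dn : d <= n)) _; rewrite leq_mul2l IH.
Qed.

(** * Cycles containing given coloured edges *)

Section ColouredCycles.
Variables (n : nat) (J E Q : finType) (blk : 'I_n.+1 -> J).
Variable ends : E -> {set 'I_n.+1}.
Hypotheses (ends_inj : injective ends) (ends2 : forall e, #|ends e| = 2).
Notation V := 'I_n.+1.
Implicit Types (s : {perm V}) (f : {ffun V -> Q}) (U : {set E * Q}).

Definition coloured_cycle s f : {set E * Q} :=
  [set y | [exists k, (ends y.1 == [set s k; s (ordS k)]) && (y.2 == f k)]].

(** Pairs are counted rather than cycles, so one coloured cycle may occur several times; the cycle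
    need not start at vertex 0 yet. *)
Definition rainbow_block_cycles : {set {perm V} * {ffun V -> Q}} :=
  setX (block_perms blk) [set f : {ffun V -> Q} | injectiveb f].

Lemma card_rainbow_block_cycles :
  #|rainbow_block_cycles| = #|block_perms blk| * #|Q| ^_ n.+1.
Proof. by rewrite cardsX card_inj_ffuns card_ord. Qed.

Lemma card_coloured_cycle_le s f : #|coloured_cycle s f| <= n.+1.
Proof.
pose g (y : E * Q) := (ends y.1, y.2).
have g_inj : injective g by move=> [e c] [e' c'] [/ends_inj -> ->].
rewrite -(card_imset _ g_inj) -[leqRHS]card_ord.
apply: leq_trans (leq_imset_card (fun k => ([set s k; s (ordS k)], f k)) _).
apply: subset_leq_card; apply/subsetP => _ /imsetP[y + ->].
rewrite inE => /existsP[k /andP[/eqP ek /eqP ck]].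
by apply/imsetP; exists k; rewrite // /g ek ck.
Qed.

(* h y is the end of the edge y towards which the cycle runs through y. *)
Definition traverses U (h : E * Q -> V) s f :=
  [forall y in U, let k := ord_pred ((s^-1)%g (h y)) in
     (ends y.1 == [set s k; h y]) && (f k == y.2)].

Lemma traversesP U h s f : reflect
  (forall y, y \in U -> exists2 k, s (ordS k) = h y &
     ends y.1 = [set s k; s (ordS k)] /\ f k = y.2)
  (traverses U h s f).
Proof.
apply: (iffP forall_inP) => H y yU.
  have /andP[/eqP He /eqP Hf] := H y yU.
  by exists (ord_pred ((s^-1)%g (h y))); rewrite ord_predK permKV.
have [k kh [He Hf]] := H y yU.
by rewrite /= -kh permK ordSK He Hf !eqxx.
Qed.

(** A vertex is entered by only one edge of the cycle, and that edge has one colour. *)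
Lemma traverses_inj U h s f : traverses U h s f -> {in U &, injective h}.
Proof.
move=> /traversesP H y y' yU y'U E'.
have [k kh [He Hf]] := H y yU; have [k' kh' [He' Hf']] := H y' y'U.
have kk' : k = k' by apply: (can_inj (@ordSK _)); apply: (@perm_inj _ s); rewrite kh kh'.
subst k'; move: He'; rewrite -He => /ends_inj eqe.
by rewrite [y]surjective_pairing [y']surjective_pairing -Hf -Hf' eqe.
Qed.

Definition oriented_successor U (h : E * Q -> V) (x : V) : option V :=
  [pick z | [exists y in U, (h y == z) && (ends y.1 == [set x; z])]].

Lemma traverses_constrained U h s f : s \in block_perms blk ->
  traverses U h s f ->
  s \in successor_constrained blk [set h y | y in U] (oriented_successor U h).
Proof.
move=> sB /traversesP H; rewrite inE sB; apply/forallP => k.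
rewrite /may_follow /oriented_successor; case: pickP => [z|none].
  case/existsP => y /and3P[yU /eqP hz /eqP yz].
  have [k' kh [He _]] := H y yU; move: He; rewrite yz -hz -kh => Hset.
  have : s k \in [set s k'; s (ordS k')] by rewrite -Hset set21.
  (* If [s k] were the head of [y], both ends of [y] would coincide. *)
  rewrite !inE => /orP[/eqP/perm_inj -> //|/eqP skz].
  by have := ends2 y.1; rewrite yz -hz -kh skz setUid cards1.
apply/imsetP => -[y yU hy]; have [k' kh [He _]] := H y yU.
have kk' : k = k' by apply: (can_inj (@ordSK _)); apply: (@perm_inj _ s); rewrite kh hy.
have /existsP[] := negbT (none (s (ordS k))); exists y.
by rewrite yU kk' kh eqxx He kh eqxx.
Qed.

Definition traversing U h := [set sf in rainbow_block_cycles | traverses U h sf.1 sf.2].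

(** For fixed [s] the edges of [U] sit at distinct positions, where any two admissible colourings
    agree. *)
Lemma card_colourings_le U h s :
  #|[set f | (s, f) \in traversing U h]| * #|Q| ^_ #|U| <= #|Q| ^_ n.+1.
Proof.
set Z := finset _; have [->|[f1]] := set_0Vmem Z; first by rewrite cards0.
rewrite 2!inE => /andP[_ /= tr1].
pose kof (y : E * Q) := ord_pred ((s^-1)%g (h y)).
have kof_inj : {in U &, injective kof}.
  move=> y y' yU y'U /(can_inj (@ord_predK _))/perm_inj.
  exact: (traverses_inj tr1).
have := card_inj_pinned [set kof y | y in U] f1.
rewrite card_in_imset // card_ord; apply: leq_trans; apply: leq_mul => //.
apply: subset_leq_card; apply/subsetP => f.
rewrite !inE /= => /andP[/andP[_ finj] /forall_inP tr]; rewrite finj /=.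
apply/forall_inP => _ /imsetP[y yU ->].
by have /andP[_ /eqP ->] := tr _ yU; have /andP[_ /eqP ->] := forall_inP tr1 _ yU.
Qed.

(** Colourings are counted for each permutation, and permutations by their constrained successors.
    In a block, the ratio of [#|B|!] to [#|B :\: D|!] is a falling factorial. *)
Lemma card_traversing_le U h (D := [set h y | y in U]) :
  #|traversing U h| * (#|Q| ^_ #|U| *
     \prod_i #|[set x | blk x == i]| ^_ #|[set x | blk x == i] :&: D|)
  <= #|D|.+1 * #|rainbow_block_cycles|.
Proof.
set SC := successor_constrained blk D (oriented_successor U h).
have le1 : #|traversing U h| * #|Q| ^_ #|U| <= #|SC| * #|Q| ^_ n.+1.
  have -> : #|traversing U h| = \sum_(s in SC) #|[set f | (s, f) \in traversing U h]|.
    rewrite -sum1_card (partition_big (fun sf => sf.1) (mem SC)) /=.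
      apply: eq_bigr => s _; rewrite -sum1_card.
      rewrite (reindex_onto (fun f => (s, f)) snd) /=.
        by apply: eq_bigl => f; rewrite [RHS]inE /= !eqxx !andbT.
      by move=> [s' f] /andP[_ /eqP /= ->].
    move=> [s f]; rewrite 2!inE /= => /andP[/andP[sB _] tr].
    exact: traverses_constrained tr.
  rewrite big_distrl /= -sum_nat_const; apply: leq_sum => s _.
  exact: card_colourings_le.
have le2 : #|SC| * \prod_i #|[set x | blk x == i]| ^_ #|[set x | blk x == i] :&: D|
    <= #|D|.+1 * #|block_perms blk|.
  apply: leq_trans (leq_mul (card_successor_constrained_le _ _ _) (leqnn _)) _.
  rewrite -mulnA leq_mul2l -big_split; apply/orP; right => /=.
  apply: leq_trans (card_block_perms_ge blk); apply: leq_prod => i _.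
  by rewrite cardsD mulnC ffact_fact // subset_leq_card // subsetIl.
rewrite card_rainbow_block_cycles mulnA.
apply: leq_trans (leq_mul le1 (leqnn _)) _.
by rewrite mulnAC [X in _ <= X]mulnA leq_mul2r le2 orbT.
Qed.

Variable b : nat.
Hypothesis blk_large : forall k, b <= #|[set x | blk x == blk k]|.

(** Replacing falling factorials by powers costs [4 ^ #|U|] for the colours and [4 ^ #|U|] for the
    vertices. If some cycle traverses [U], its heads are distinct, so [#|D| = #|U|]. *)
Lemma card_traversing_pow_le U h : n < #|Q| ->
  #|traversing U h| * (b * #|Q|) ^ #|U| <= #|U|.+1 * 16 ^ #|U| * #|rainbow_block_cycles|.
Proof.
move=> nQ.
have [->|[[s f]]] := set_0Vmem (traversing U h); first by rewrite cards0.
rewrite 2!inE /= => /andP[_ tr].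
pose D := [set h y | y in U].
have cardD : #|D| = #|U| by rewrite card_in_imset //; apply: traverses_inj tr.
have := card_traversing_le U h; lazy zeta; rewrite -/D cardD.
set M := _ ^_ _ * _ => le.
have leM : (b * #|Q|) ^ #|U| <= 16 ^ #|U| * M.
  rewrite mulnC expnMn -[16]/(4 * 4) expnMn mulnACA; apply: leq_mul.
    apply: ffact_ge; rewrite -cardD; apply: leq_trans (max_card _) _.
    by rewrite card_ord.
  pose d i := #|[set x | blk x == i] :&: D|.
  have sumd : #|U| = \sum_i d i.
    rewrite -cardD -sum1_card (partition_big blk xpredT) //=.
    apply: eq_bigr => i _; rewrite /d -sum1_card; apply: eq_bigl => x.
    by rewrite !inE andbC.
  rewrite [in b ^ _]sumd [in 4 ^ _]sumd !expn_sum -big_split /=.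
  apply: leq_prod => i _.
  (* An index outside the image of [blk] has an empty class, to which the bound [b] does not
     apply. *)
  have [d0|d0] := posnP (d i); first by rewrite /d in d0 *; rewrite d0.
  have [x xi] : exists x, blk x = i.
    by move: d0; rewrite card_gt0 => /set0Pn[x]; rewrite !inE => /andP[/eqP]; exists x.
  apply: leq_trans (ffact_ge _); last by rewrite subset_leq_card ?subsetIl.
  by rewrite leq_exp2r // -xi.
apply: leq_trans (leq_mul (leqnn _) leM) _.
by rewrite mulnCA -mulnA [leqRHS]mulnCA leq_mul2l le orbT.
Qed.

(** Choosing the head of every edge of [U] gives [2 ^ #|U|] orientations, and [#|U|.+1 <= 2 ^ #|U|];
    hence [64 = 2 * 2 * 16]. *)
Lemma card_containing_pow_le U : n < #|Q| ->
  #|[set sf in rainbow_block_cycles | U \subset coloured_cycle sf.1 sf.2]|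
    * (b * #|Q|) ^ #|U| <= 64 ^ #|U| * #|rainbow_block_cycles|.
Proof.
move=> nQ.
pose heads := [set h : {ffun E * Q -> V} |
  h \in pfamily ord0 (mem U) (fun y => mem (ends y.1))].
have card_heads : #|heads| = 2 ^ #|U|.
  rewrite cardsE card_pfamily -prod_nat_const foldrE big_map big_enum /=.
  by apply: eq_bigr => y _; rewrite -(ends2 y.1); apply: eq_card.
apply: (@leq_trans ((\sum_(h in heads) #|traversing U h|) * (b * #|Q|) ^ #|U|)).
  rewrite leq_mul2r; apply/orP; right.
  apply: (@leq_trans #|\bigcup_(h in heads) traversing U h|); last first.
    elim/big_ind2: _ => [|A m B k lem lek|//]; first by rewrite cards0.
    exact: leq_trans (leq_card_setU _ _) (leq_add lem lek).
  apply: subset_leq_card; apply/subsetP => -[s f]; rewrite inE /= => /andP[sfR /subsetP US].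
  have ex y : exists k, (y \in U) ==> (ends y.1 == [set s k; s (ordS k)]) && (y.2 == f k).
    case: (boolP (y \in U)) => [/US|_]; last by exists ord0.
    by rewrite inE => /existsP.
  pose kk y := xchoose (ex y).
  pose h : {ffun E * Q -> V} := [ffun y => if y \in U then s (ordS (kk y)) else ord0].
  have kkP y : y \in U -> ends y.1 = [set s (kk y); s (ordS (kk y))] /\ y.2 = f (kk y).
    move=> yU; have /implyP/(_ yU)/andP[/eqP ? /eqP ?] := xchooseP (ex y).
    by split.
  apply/bigcupP; exists h.
    rewrite inE; apply/pfamilyP; split=> [|y yU].
      by apply/subsetP => y; rewrite unfold_in /= ffunE; case: ifP => //; rewrite eqxx.
    rewrite ffunE yU; have [E1 _] := kkP y yU.
    suff : s (ordS (kk y)) \in ends y.1 by []; by rewrite E1 set22.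
  rewrite inE sfR; apply/traversesP => y yU; exists (kk y); first by rewrite ffunE yU.
  by have [-> ->] := kkP y yU.
rewrite big_distrl /=.
apply: (@leq_trans (\sum_(h in heads) #|U|.+1 * 16 ^ #|U| * #|rainbow_block_cycles|)).
  by apply: leq_sum => h _; apply: card_traversing_pow_le.
rewrite sum_nat_const card_heads mulnA leq_mul2r; apply/orP; right.
rewrite -[64]/(2 * (2 * 16)) !expnMn leq_mul2l; apply/orP; right.
by rewrite leq_mul2r ltn_expl ?orbT.
Qed.

End ColouredCycles.

Section SpreadCost.
Variables (R : realFieldType) (n : nat) (J E Q : finType) (blk : 'I_n.+1 -> J).
Variable ends : E -> {set 'I_n.+1}.
Hypotheses (ends_inj : injective ends) (ends2 : forall e, #|ends e| = 2).
Variable b : nat.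
Hypothesis blk_large : forall k, b <= #|[set x | blk x == blk k]|.

Definition cycle_hypergraph : {set {set E * Q}} :=
  [set coloured_cycle ends sf.1 sf.2 | sf in rainbow_block_cycles Q blk].

(** Each pair contains a member of [C], so the fractions of pairs containing the single members of
    [C] add up to at least 1. *)
Lemma cost_cover_cycles_ge1 (C : {set {set E * Q}}) : 0 < b -> n < #|Q| ->
  covers C cycle_hypergraph -> (1 <= cost (64%:R / (b * #|Q|)%:R : R) C)%R.
Proof.
move=> b0 nQ cov; pose Om := rainbow_block_cycles Q blk.
have Om0 : 0 < #|Om|.
  rewrite card_rainbow_block_cycles muln_gt0 ffact_gt0 nQ andbT.
  by apply/card_gt0P; exists 1%g; rewrite inE; apply/forallP => x; rewrite perm1.
have bQ0 : (0 < (b * #|Q|)%:R :> R)%R.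
  by rewrite ltr0n muln_gt0 b0 /=; apply: leq_ltn_trans nQ.
pose Om_of (U : {set E * Q}) := [set sf in Om | U \subset coloured_cycle ends sf.1 sf.2].
have OmU : (#|Om|%:R <= \sum_(U in C) #|Om_of U|%:R :> R)%R.
  rewrite -natr_sum ler_nat; apply: (@leq_trans #|\bigcup_(U in C) Om_of U|).
    apply: subset_leq_card; apply/subsetP => sf sfO.
    have [|U UC US] := cov (coloured_cycle ends sf.1 sf.2); first exact: imset_f.
    by apply/bigcupP; exists U; rewrite // inE sfO.
  elim/big_ind2: _ => [|X m Y k lem lek|//]; first by rewrite cards0.
  exact: leq_trans (leq_card_setU _ _) (leq_add lem lek).
rewrite -(@ler_pM2r _ (#|Om|%:R : R)%R) ?ltr0n // mul1r; apply: le_trans OmU _.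
rewrite /cost mulr_suml; apply: ler_sum => U _.
rewrite expr_div_n mulrAC ler_pdivlMr ?exprn_gt0 // -!natrX -!natrM ler_nat.
exact: card_containing_pow_le.
Qed.

End SpreadCost.

(** * Division of the vertices into consecutive blocks *)

Section Blocks.
Variables (n b : nat).
Hypotheses (b0 : 0 < b) (bn : b <= n.+1).

Lemma block_subproof (k : 'I_n.+1) : minn (k %/ b) (n.+1 %/ b).-1 < n.+1.
Proof.
apply: leq_ltn_trans (geq_minl _ _) _.
by apply: leq_ltn_trans (leq_div _ _) (ltn_ord k).
Qed.

(* The remainder of the division is merged into the last full block. *)
Definition block (k : 'I_n.+1) : 'I_n.+1 := Ordinal (block_subproof k).

Lemma block_mono (x y : 'I_n.+1) : x <= y -> block x <= block y.
Proof. by move=> xy /=; rewrite leq_min geq_minr andbT geq_min leq_div2r. Qed.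

Lemma block_size_ge (k : 'I_n.+1) : b <= #|[set x | block x == block k]|.
Proof.
have c0 : 0 < n.+1 %/ b by rewrite divn_gt0.
have := leq_divM n.+1 b; set c := n.+1 %/ b in c0 * => cb.
have := geq_minr (k %/ b) c.-1; rewrite -/(nat_of_ord (block k)) => ic.
rewrite -[leqLHS](size_iota (block k * b)) cardE -(size_map val).
apply: uniq_leq_size; first exact: iota_uniq.
move=> t; rewrite mem_iota => /andP[t1 t2].
have tb : t %/ b = block k.
  apply/eqP; rewrite eqn_leq leq_divRL // t1 andbT -ltnS ltn_divLR //.
  by rewrite mulSn addnC.
have tn : t < n.+1.
  apply: leq_trans t2 _; apply: leq_trans cb; rewrite -mulSnr leq_mul2r.
  by apply/orP; right; rewrite -(prednK c0) ltnS.
apply/mapP; exists (Ordinal tn); rewrite // mem_enum inE -val_eqE /= tb.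
exact/eqP/minn_idPl.
Qed.

(** Each class lies in an interval of length [b.*2], since the remainder merged into the last block
    is shorter than [b]. *)
Lemma block_size_le (k : 'I_n.+1) : #|[set x | block x == block k]| <= b.*2.
Proof.
have c0 : 0 < n.+1 %/ b by rewrite divn_gt0.
have cb : n.+1 < (n.+1 %/ b).+1 * b by rewrite ltn_ceil.
rewrite -(size_iota (block k * b) b.*2) cardE -(size_map val).
apply: uniq_leq_size.
  by rewrite map_inj_uniq ?enum_uniq //; apply: val_inj.
move=> _ /mapP[x + ->]; rewrite mem_enum inE -val_eqE /= => /eqP <-.
have x1 := leq_divM x b; have x2 := ltn_ceil x b0; have xn := ltn_ord x.
rewrite mem_iota; move: c0 cb x1 x2; case: (n.+1 %/ b) => // c _.
set d := x %/ b; rewrite !mulSn /minn /= => cb x1 x2.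
case: ltnP => dc; first by apply/andP; split=> //; lia.
have := leq_mul dc (leqnn b); lia.
Qed.

End Blocks.

(** * Rotating a cycle to start at vertex 0 *)

Section Rotation.
Variables (n : nat) (blk : 'I_n.+1 -> 'I_n.+1) (B : nat).
Hypothesis blk_mono : forall x y : 'I_n.+1, x <= y -> blk x <= blk y.
Hypothesis blk_small : forall k, #|[set x | blk x == blk k]| <= B.

Lemma val_iter_ordS j (k : 'I_n.+1) : iter j (@ordS _) k = (k + j) %% n.+1 :> nat.
Proof.
elim: j => [|j IH]; first by rewrite addn0 modn_small.
by rewrite iterS /= IH -addn1 modnDml addn1 addnS.
Qed.

(** An inversion whose positions keep their order under [r] lies within one block. Otherwise the
    later position has wrapped around to at most [j], the position of vertex 0, hence into the block
    of 0. Each kind has at most [n.+1 * B] pairs. *)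
Lemma rotation_inversions (s : {perm 'I_n.+1}) : s \in block_perms blk ->
  exists H : {perm 'I_n.+1}, exists r : 'I_n.+1 -> 'I_n.+1,
  [/\ injective r, forall k, H k = s (r k), forall k, H (ordS k) = s (ordS (r k)),
      H ord0 = ord0 & inversions H <= (n.+1 * B).*2].
Proof.
rewrite inE => /forallP sB; pose j := (s^-1)%g ord0.
pose r := iter j (@ordS n.+1).
have r_inj : injective r.
  by rewrite /r; elim: (nat_of_ord j) => // m IH x y /= /(can_inj (@ordSK _))/IH.
have H_inj : injective (s \o r) by apply: inj_comp => //; apply: perm_inj.
exists (perm H_inj), r; split=> //.
- by move=> k; rewrite permE.
- by move=> k; rewrite permE /= /r -iterSr.
- rewrite permE /=; have -> : r ord0 = j.
    by apply: val_inj; rewrite [LHS]val_iter_ordS add0n modn_small.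
  by rewrite permKV.
pose g (p : 'I_n.+1 * 'I_n.+1) := (r p.1, r p.2).
have g_inj : injective g by move=> [x y] [x' y'] [/r_inj -> /r_inj ->].
rewrite /inversions -(card_imset _ g_inj).
pose X1 := [set p : 'I_n.+1 * 'I_n.+1 | blk p.1 == blk p.2].
pose X2 := setX [set: 'I_n.+1] [set y | blk y == blk ord0].
apply: (@leq_trans #|X1 :|: X2|); last first.
  apply: leq_trans (leq_card_setU _ _) _; rewrite -addnn; apply: leq_add.
    rewrite -sum1dep_card -(pair_big_dep xpredT (fun x y => blk x == blk y) (fun _ _ => 1)) /=.
    rewrite -[in leqRHS](card_ord n.+1) -sum_nat_const; apply: leq_sum => x _.
    rewrite sum1dep_card; apply: leq_trans (blk_small x); apply: eq_leq.
    by apply: eq_card => y; rewrite !inE eq_sym.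
  by rewrite cardsX cardsT card_ord leq_mul2l blk_small orbT.
apply: subset_leq_card; apply/subsetP => _ /imsetP[[k l] + ->].
rewrite !inE /= !permE /= => /andP[kl inv].
have [rkl|rlk] := ltnP (r k) (r l).
  apply/orP; left; rewrite -val_eqE eqn_leq (blk_mono (ltnW rkl)) /=.
  by rewrite -(eqP (sB (r k))) -(eqP (sB (r l))) blk_mono // ltnW.
apply/orP; right; rewrite -val_eqE eqn_leq (@blk_mono ord0 (r l)) // andbT.
have -> : blk ord0 = blk j by rewrite -(eqP (sB j)) permKV.
apply: blk_mono; move: rlk; rewrite /r !val_iter_ordS.
have := ltn_ord k; have := ltn_ord l; have := ltn_ord j.
move: (nat_of_ord j) (nat_of_ord l) (nat_of_ord k) kl => u v w kl un vn wn.
have [h|h] := ltnP (v + u) n.+1; first by rewrite !modn_small; lia.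
move=> _; rewrite -(subnK h) modnDr modn_small; lia.
Qed.

End Rotation.

Lemma card_pedge n (e : pedge n) : #|val e| = 2.
Proof. exact/eqP/(valP e). Qed.

Lemma has_rainbow_HC_of_cycle (R : realType) (n q B : nat) (eps : R)
    (blk : 'I_n.+1 -> 'I_n.+1) (w : cgraph n.+1 q) :
    (forall x y : 'I_n.+1, x <= y -> blk x <= blk y) ->
    (forall k, #|[set x | blk x == blk k]| <= B) -> 2 < n.+1 ->
    ((n.+1 * B).*2%:R <= eps * n.+1%:R ^+ 2)%R ->
    contains_edge (cycle_hypergraph 'I_q blk (fun e : pedge n.+1 => val e))
      (coloured_edges w) ->
  has_rainbow_HC eps w.
Proof.
move=> mono small n3 Beps /existsP[S /andP[/imsetP[[s f]]]].
rewrite !inE /= => /andP[/forallP sB /injectiveP finj] -> /subsetP sub.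
have [|H [r [r_inj Hr HrS H0 inv]]] := rotation_inversions mono small (s := s).
  by rewrite inE; apply/forallP.
have colour k : edge_colour w (H k) (H (ordS k)) = Some (f (r k)).
  rewrite Hr HrS /edge_colour.
  have card2 : #|[set s (r k); s (ordS (r k))]| == 2.
    rewrite cards2 (inj_eq perm_inj) eqSS eqb1; apply/eqP => /(congr1 val) /=.
    have := ltn_ord (r k); move: (nat_of_ord (r k)) => v vn.
    have [h|h] := ltnP v.+1 n.+1; first by rewrite modn_small //; lia.
    have -> : v.+1 = n.+1 by lia.
    by rewrite modnn; lia.
  rewrite insubT /=.
  have := sub (Sub [set s (r k); s (ordS (r k))] card2, f (r k)).
  rewrite !inE /= => /(_ _)/eqP -> //.
  by apply/existsP; exists (r k); rewrite !eqxx.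
apply/existsP; exists H; apply/and3P; split.
- apply/and3P; split=> //.
    apply/forallP => k; apply/implyP => /eqP k0.
    by have -> : k = ord0 by [apply: val_inj]; rewrite H0.
  by apply/forallP => k; rewrite colour.
- by apply/injectiveP => k l; rewrite !colour => -[/finj/r_inj].
- by apply: le_trans Beps; rewrite ler_nat.
Qed.

From mathcomp Require Import all_classical all_reals all_analysis.
Import numFieldNormedType.Exports.
Local Open Scope ring_scope.

(** * The probability bound *)

(** Two positions with the same edge would each be the successor of the other, which is impossible
    with at least 3 vertices. *)
Lemma coloured_cycle_fst_inj (n : nat) (E Q : finType) (ends : E -> {set 'I_n.+1})
    (s : {perm 'I_n.+1}) (f : {ffun 'I_n.+1 -> Q}) : (2 < n.+1)%N ->
  {in coloured_cycle ends s f &, injective fst}.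
Proof.
move=> n3 [e c] [e' c']; rewrite !inE /= => /existsP[k /andP[/eqP ek /eqP ->]].
move=> /existsP[k' /andP[/eqP ek' /eqP ->]] ee'; congr (_, f _) => //.
have eqS : [set s k; s (ordS k)] = [set s k'; s (ordS k')] by rewrite -ek -ek' ee'.
have : s k \in [set s k'; s (ordS k')] by rewrite -eqS set21.
have : s k' \in [set s k; s (ordS k)] by rewrite eqS set21.
rewrite !inE !(inj_eq perm_inj) => /orP[/eqP -> //|/eqP k'S] /orP[/eqP //|/eqP kS].
have := congr1 (@nat_of_ord _) k'S; have := congr1 (@nat_of_ord _) kS => /=.
have := ltn_ord k; have := ltn_ord k'.
move: (nat_of_ord k) (nat_of_ord k') => u v vn un.
have modS x : (x < n.+1)%N -> (x.+1 %% n.+1 = x.+1 \/ (x = n /\ x.+1 %% n.+1 = 0))%N.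
  move=> xn; have [h|h] := ltnP x.+1 n.+1; first by left; rewrite modn_small.
  by right; have -> : x = n by [lia]; rewrite modnn.
case: (modS _ un) => [->|[un' ->]]; case: (modS _ vn) => [->|[vn' ->]]; lia.
Qed.

Section FiniteBound.
Variables (R : realType) (n q : nat) (p : R).

Definition slot_prob (o : option 'I_q) : R := if o is Some _ then p / q%:R else 1 - p.

Lemma colgnp_prod (w : cgraph n q) : colgnp p w = \prod_e slot_prob (w e).
Proof.
rewrite /colgnp /gnp [X in _ * X]big_mkcond -big_split /=.
apply: eq_bigr => e _; rewrite inE /slot_prob.
by case: (w e) => [c|] /=; rewrite ?mulr1.
Qed.

Lemma sum_colgnp : (0 < q)%N -> \sum_w colgnp p (w : cgraph n q) = 1.
Proof.
move=> q0; under eq_bigr => w _ do rewrite colgnp_prod.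
rewrite -(bigA_distr_bigA (fun _ => slot_prob)) big1 // => e _.
rewrite (bigID (fun o : option 'I_q => isSome o)) /=.
have -> : \sum_(o : option 'I_q | ~~ isSome o) slot_prob o = 1 - p.
  by rewrite (bigD1 None) //= big_pred0 ?addr0 // => -[].
rewrite (reindex_onto Some (odflt (Ordinal q0))) /=; last by case.
rewrite (eq_bigl xpredT) => [|c]; last by rewrite eqxx.
rewrite sumr_const card_ord -[_ *+ _]mulr_natr mulfVK ?pnatr_eq0 -?lt0n //.
by rewrite subrKC.
Qed.

Lemma colgnp_ge0 (w : cgraph n q) : 0 <= p <= 1 -> 0 <= colgnp p w.
Proof.
move=> /andP[p0 p1]; rewrite colgnp_prod; apply: prodr_ge0 => e _.
by rewrite /slot_prob; case: (w e) => [c|]; rewrite ?subr_ge0 ?divr_ge0.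
Qed.

Lemma Pr_colgnp_le1 (P : pred (cgraph n q)) : (0 < q)%N -> 0 <= p <= 1 ->
  Pr_colgnp p P <= 1.
Proof.
move=> q0 p01; rewrite -(sum_colgnp q0) /Pr_colgnp [leRHS](bigID P) /= lerDl.
by apply: sumr_ge0 => w _; apply: colgnp_ge0.
Qed.

End FiniteBound.

(** [park_pham] with [a = 1] bounds the failure for independent coloured edges of density [rho];
    [unique_colour_fail_le] carries the bound over to the coloured random graph. *)
Lemma rainbow_HC_prob_ge (R : realType) (n q b J : nat) (eps p : R) (L : nat -> R)
    (rho := \sum_(j < J) L j * (64%:R / (b * q)%:R)) :
    (2 < n.+1)%N -> (n < q)%N -> 0 <= p <= 1 ->
    (0 < b)%N -> (b <= n.+1)%N -> (n.+1 < 2 ^ J)%N -> (forall j, 1 <= L j) ->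
    ((n.+1 * b.*2).*2)%:R <= eps * n.+1%:R ^+ 2 -> rho <= p / q%:R ->
  1 - \sum_(j < J) (4%:R / L j) ^+ (2 ^ j)
  <= Pr_colgnp p (@has_rainbow_HC R n.+1 q eps).
Proof.
move=> n3 nq p01 b0 bn nJ L1 Beps rhop.
have q0 : (0 < q)%N by apply: leq_ltn_trans nq.
have q1 : 1 <= q%:R :> R by rewrite ler1n.
have w0 : 0 < 64%:R / (b * q)%:R :> R by rewrite divr_gt0 // ltr0n muln_gt0 b0.
have rho01 : 0 <= rho <= 1.
  apply/andP; split.
    by apply: sumr_ge0 => j _; rewrite mulr_ge0 ?(ltW w0) // (le_trans ler01).
  apply: le_trans rhop _; case/andP: p01 => _ p1.
  by rewrite ler_pdivrMr ?mul1r ?(le_trans p1) // (lt_le_trans ltr01).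
pose H := cycle_hypergraph 'I_q (@block n b) (fun e : pedge n.+1 => val e).
have fail : fail_prob rho H <= \sum_(j < J) (4%:R / L j) ^+ (2 ^ j).
  rewrite -[leLHS]mul1r; apply: park_pham => //.
  - move=> _ /imsetP[sf _ ->]; apply: leq_ltn_trans nJ.
    by apply: card_coloured_cycle_le; apply: val_inj.
  - by case/andP: rho01.
  - move=> C covC.
    have := @cost_cover_cycles_ge1 R n _ (pedge n.+1) 'I_q (@block n b)
      (fun e => val e) val_inj (@card_pedge _) b (block_size_ge b0 bn) C b0.
    by rewrite card_ord => /(_ nq covC).
have := sum_colgnp n.+1 p q0; rewrite (bigID (@has_rainbow_HC R n.+1 q eps)) /=.
rewrite -/(Pr_colgnp p (@has_rainbow_HC R n.+1 q eps)) => total.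
rewrite lerBlDr -[leLHS]total lerD2l; apply: le_trans fail.
have := @unique_colour_fail_le R (pedge n.+1) 'I_q p rho H.
rewrite card_ord => /(_ q0 p01 rho01 rhop) cmp; apply: le_trans (cmp _); last first.
  by move=> _ /imsetP[sf _ ->]; apply: coloured_cycle_fst_inj.
rewrite big_mkcond /=; apply: ler_sum => w _.
case: ifP => [nhas|_]; last by rewrite -colgnp_prod mulr_ge0 ?colgnp_ge0.
rewrite colgnp_prod; case: (boolP (contains_edge H _)) => [/has_rainbow_HC_of_cycle|_].
  move=> /(_ R b.*2 eps) has; case/negP: nhas; apply: has => //.
  - by move=> x y; apply: block_mono.
  - by move=> k; apply: block_size_le.
by rewrite mulr1.
Qed.

(** * The densities of the rounds *)

(** Only rounds with [j <= c] need a large scale, their exponent [2 ^ j] being small; later ones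
    have ratio [4 / 8] and a large exponent. *)
Definition stage_scale (R : realType) (c j : nat) : R :=
  8%:R * (if (j <= c)%N then 2%:R ^+ c else 1).

Lemma stage_scale_ge1 (R : realType) c j : 1 <= stage_scale R c j.
Proof.
rewrite /stage_scale -natrX.
case: ifP => _; last by rewrite mulr1 ler1n.
by rewrite -natrM ler1n muln_gt0 expn_gt0.
Qed.

Lemma sum_stage_scale_le (R : realType) c J :
  \sum_(j < J) stage_scale R c j <= 8%:R * J%:R + 8%:R * 2%:R ^+ c * c.+1%:R.
Proof.
apply: (@le_trans _ _ (\sum_(j < J) (8%:R + (if (j < c.+1)%N then 8%:R * 2%:R ^+ c else 0)))).
  apply: ler_sum => j _; rewrite /stage_scale ltnS.
  by case: ifP => _; rewrite ?mulr1 ?addr0 ?lerDr.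
rewrite big_split /= sumr_const card_ord mulr_natr lerD2l.
rewrite -big_mkcond /= sumr_const -[leLHS]mulr_natr ler_wpM2l ?mulr_ge0 ?exprn_ge0 //.
rewrite ler_nat -[leqRHS]card_ord.
have inj : {in [pred j : 'I_J | (j < c.+1)%N] &, injective (fun j : 'I_J => inord j : 'I_c.+1)}.
  by move=> x y; rewrite !inE => xc yc /(congr1 val); rewrite /= !inordK // => /val_inj.
by rewrite -(card_in_imset inj) max_card.
Qed.

Lemma sum_stage_error_le (R : realType) c J :
  \sum_(j < J) (4%:R / stage_scale R c j) ^+ (2 ^ j) <= 2%:R^-1 ^+ c.
Proof.
have half0 : 0 <= 2%:R^-1 :> R by rewrite invr_ge0.
have half1 : 2%:R^-1 <= 1 :> R by rewrite invf_le1 ?ler1n.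
apply: (@le_trans _ _ (\sum_(j < J) 2%:R^-1 ^+ (c + j).+1)).
  apply: ler_sum => j _.
  have -> : 4%:R / stage_scale R c j = 2%:R^-1 ^+ (if (j <= c)%N then c.+1 else 1).
    rewrite /stage_scale; case: ifP => _.
      rewrite exprS exprVn; field; rewrite expf_neq0 //; lra.
    by rewrite expr1; field.
  rewrite -exprM; apply: ler_wiXn2l => //.
  have j2 : (j < 2 ^ j)%N by rewrite ltn_expl.
  (* For [j <= c], [(c + 1) * 2 ^ j >= (c + 1) * (j + 1) >= c + j + 1]; for [j > c],
     [2 ^ j >= 2 * j >= c + j + 1]. *)
  case: (leqP j c) => jc.
    by apply: leq_trans (leq_mul (leqnn c.+1) j2); rewrite mulSn mulnS; lia.
  rewrite mul1n; case: (nat_of_ord j) jc => // i; rewrite expnS ltnS => ci.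
  have : (i < 2 ^ i)%N by rewrite ltn_expl.
  lia.
suff <- : \sum_(j < J) 2%:R^-1 ^+ (c + j).+1 + 2%:R^-1 ^+ (c + J) = 2%:R^-1 ^+ c :> R.
  by rewrite lerDl exprn_ge0.
elim: J => [|J IH]; first by rewrite big_ord0 add0r addn0.
rewrite big_ord_recr /= -[RHS]IH -addrA; congr (_ + _).
by rewrite addnS !exprS; field.
Qed.

Lemma trunc_log2_le_ln (R : realType) (n : nat) : (0 < n)%N ->
  (trunc_log 2 n)%:R <= ln n%:R / ln 2%:R :> R.
Proof.
move=> n0; have ln2 : 0 < ln 2%:R :> R by rewrite ln_gt0 // ltr1n.
rewrite ler_pdivlMr // mulr_natl -lnXn // -natrX ler_ln ?posrE ?ltr0n ?expn_gt0 //.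
by rewrite ler_nat trunc_logP.
Qed.

(** * Choice of constants and passage to the limit *)

Local Open Scope classical_set_scope.
Local Open Scope ring_scope.

Theorem theorem7 (R : realType) (eps : R) (heps : 0 < eps) :
  exists2 K : R, 0 < K &
    forall (q : nat -> nat) (p : nat -> R),
      (forall n : nat, (n <= q n)%N) ->
      (forall n : nat, 0 <= p n <= 1) ->
      (\forall n \near \oo, K * ln (n%:R : R) / n%:R <= p n) ->
      (fun n : nat => Pr_colgnp (p n) (@has_rainbow_HC R n (q n) eps)) @ \oo
        --> (1 : R).
Proof.
have ln2 : 0 < ln 2%:R :> R by rewrite ln_gt0 // ltr1n.
pose m := (Num.truncn (4%:R / eps)).+1.
have m_eps : 4%:R <= eps * m%:R.
  by rewrite -ler_pdivrMl // mulrC ltW // truncnS_gt.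
(* The factor [8 / ln 2 + 1] bounds the total scale over [ln n]; [128 * m] is 64 times the [2 * m]
   from [n <= 2 * b * m]. *)
pose K : R := 128%:R * m%:R * (8%:R / ln 2%:R + 1).
have K0 : 0 < K by rewrite !mulr_gt0 ?ltr0n // addr_gt0 // divr_gt0.
exists K => // q p nq p01 pK; apply/cvgrPdist_le => e e0.
(* Only [c] depends on the error [e]; [K] does not. *)
pose c := (Num.truncn e^-1).+1.
have ce : 2%:R^-1 ^+ c <= e.
  rewrite exprVn -[leRHS]invrK lef_pV2 ?posrE ?invr_gt0 ?exprn_gt0 //.
  apply: (@le_trans _ _ c%:R); first by rewrite ltW // truncnS_gt.
  by rewrite -natrX ler_nat ltnW // ltn_expl.
(* The part of the total scale that does not grow with [n], absorbed by [ln n] for large [n]. *)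
pose A : R := 8%:R + 8%:R * 2%:R ^+ c * c.+1%:R.
suff main n : (2 < n)%N -> (m <= n)%N -> A <= ln (n%:R : R) ->
    K * ln (n%:R : R) / n%:R <= p n ->
    `|1 - Pr_colgnp (p n) (@has_rainbow_HC R n (q n) eps)| <= e.
  near=> n; apply: main.
  - by near: n; exact: nbhs_infty_gt.
  - by near: n; exact: nbhs_infty_ge.
  - have n1 : ((Num.truncn (expR A)).+1 <= n)%N by near: n; exact: nbhs_infty_ge.
    rewrite -[A]expRK ler_ln ?posrE ?expR_gt0 ?ltr0n 1?(leq_ltn_trans _ n1) //.
      apply: (@le_trans _ _ (Num.truncn (expR A)).+1%:R); last by rewrite ler_nat.
      by rewrite ltW // truncnS_gt.
  - by near: n.
case: n => [//|n] n3 mn An pKn.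
have n0 : (0 : R) < n.+1%:R by rewrite ltr0n.
have m0 : (0 : R) < m%:R by rewrite ltr0n.
pose b := (n.+1 %/ m)%N.
have b0 : (0 < b)%N by rewrite divn_gt0.
have bn : (b <= n.+1)%N by apply: leq_div.
have bm1 : (b * m <= n.+1)%N by apply: leq_divM.
have bm2 : (n.+1 <= b.*2 * m)%N.
  have : (n.+1 < b.+1 * m)%N by rewrite ltn_ceil.
  rewrite -addnn mulnDl mulSn => /ltnW/leq_trans; apply.
  by rewrite leq_add2r leq_pmull.
pose J := (trunc_log 2 n.+1).+1.
have nJ : (n.+1 < 2 ^ J)%N by apply: trunc_log_ltn.
have q0 : (0 : R) < (q n.+1)%:R by rewrite ltr0n (leq_trans _ (nq _)).
have b0' : (0 : R) < b%:R by rewrite ltr0n.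
(* Blocks have at most [2 * b] vertices, and [b] is at most [n.+1 / m], where [m] is at least
   [4 / eps]. *)
have Beps : ((n.+1 * b.*2).*2)%:R <= eps * n.+1%:R ^+ 2.
  have bm : b%:R * m%:R <= n.+1%:R :> R by rewrite -natrM ler_nat.
  have eb : 4%:R * b%:R <= eps * n.+1%:R :> R.
    apply: (@le_trans _ _ (eps * m%:R * b%:R)); first by rewrite ler_pM2r.
    by rewrite -mulrA ler_pM2l // mulrC.
  have -> : ((n.+1 * b.*2).*2)%:R = n.+1%:R * (4%:R * b%:R) :> R.
    rewrite -!muln2 !natrM; ring.
  by rewrite expr2 [leRHS]mulrCA ler_pM2l.
have sumL : \sum_(j < J) stage_scale R c j <= (8%:R / ln 2%:R + 1) * ln n.+1%:R.
  apply: le_trans (sum_stage_scale_le _ _ _) _.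
  have := @trunc_log2_le_ln R n.+1 isT; rewrite /J -[(trunc_log _ _).+1]addn1 natrD.
  move: An; rewrite /A; set t := (trunc_log 2 n.+1)%:R; set l := ln _.
  have -> : (8%:R / ln 2%:R + 1) * l = 8%:R * (l / ln 2%:R) + l by ring.
  lra.
have rhop : \sum_(j < J) stage_scale R c j * (64%:R / (b * q n.+1)%:R)
    <= p n.+1 / (q n.+1)%:R.
  rewrite -mulr_suml natrM invfM !mulrA ler_pM2r ?invr_gt0 //.
  apply: le_trans pKn; rewrite ler_pdivrMr // mulrAC ler_pdivlMr //.
  apply: (@le_trans _ _ ((8%:R / ln 2%:R + 1) * ln n.+1%:R * 64%:R * (b.*2 * m)%:R)).
    apply: ler_pM; rewrite ?ler_nat //; last by rewrite ler_wpM2r.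
    rewrite mulr_ge0 // sumr_ge0 // => j _.
    exact: le_trans ler01 (stage_scale_ge1 R c j).
  rewrite /K -muln2 !natrM; rewrite le_eqVlt; apply/orP; left; apply/eqP; ring.
have := rainbow_HC_prob_ge n3 (nq _) (p01 _) b0 bn nJ (stage_scale_ge1 R c) Beps rhop.
have := sum_stage_error_le R c J.
have := @Pr_colgnp_le1 R n.+1 (q n.+1) (p n.+1) (@has_rainbow_HC R n.+1 (q n.+1) eps)
  (leq_trans (ltn0Sn n) (nq _)) (p01 _).
move=> le1 err ge; rewrite ger0_norm ?subr_ge0 //; lra.
Unshelve. all: by end_near.
Qed.
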